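(* Let $(v_i)_{i\in\mathbb{Z}}$ be a sequence of real numbers, with jumps $\Delta v_{i+1/2} = v_{i+1}-v_i$, and let $[\![v]\!]_{i+1/2} = v^+_{i+1/2}-v^-_{i+1/2}$ be the jumps of its SP-WENO reconstruction (defined in the context). Then $$\bigl|[\![v]\!]_{i+1/2}\bigr| \le 2\,\bigl|\Delta v_{i+1/2}\bigr| \qquad \text{for all } i\in\mathbb{Z}.$$
   Context: Definition of the SP-WENO reconstruction. Let $(v_i)_{i\in\mathbb{Z}}$ be real numbers (cell values on a uniform one-dimensional mesh), and write $\Delta v_{i+1/2}=v_{i+1}-v_i$. For each $i\in\mathbb{Z}$ the reconstructed values at the interface $i+1/2$ are $$v^-_{i+1/2} = w_0\Bigl(\tfrac{v_i}{2}+\tfrac{v_{i+1}}{2}\Bigr)+w_1\Bigl(-\tfrac{v_{i-1}}{2}+\tfrac{3v_i}{2}\Bigr),\qquad v^+_{i+1/2} = \widetilde w_0\Bigl(-\tfrac{v_{i+2}}{2}+\tfrac{3v_{i+1}}{2}\Bigr)+\widetilde w_1\Bigl(\tfrac{v_i}{2}+\tfrac{v_{i+1}}{2}\Bigr),$$ where the weights $w_0,w_1,\widetilde w_0,\widetilde w_1$ depend on the interface $i+1/2$ and are chosen as follows. (a) If $\Delta v_{i+1/2}=0$: $w_1=\widetilde w_0=0$ and $w_0=\widetilde w_1=1$. (b) If $\Delta v_{i+1/2}\neq 0$: put $\theta^+_i=\Delta v_{i-1/2}/\Delta v_{i+1/2}$ and $\theta^-_{i+1}=\Delta v_{i+3/2}/\Delta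 v_{i+1/2}$, and set $$w_0=\tfrac34+2C_1,\quad w_1=\tfrac14-2C_1,\quad \widetilde w_0=\tfrac14-2C_2,\quad \widetilde w_1=\tfrac34+2C_2,$$ with $C_1=C_1(\theta^+_i,\theta^-_{i+1})$ and $C_2=C_2(\theta^+_i,\theta^-_{i+1})$ given by the following functions. For real $a,b$ with $a\ne 1$ let $\psi^+(a,b)=\frac{1-b}{1-a}$. Let $$f^+(a,b)=\begin{cases}\dfrac{1}{1+\psi^+(a,b)} & \text{if } a\neq 1 \text{ and } \psi^+(a,b)\neq -1,\\ 1 & \text{otherwise,}\end{cases}\qquad f^-(a,b)=f^+(b,a).$$ Then $$C_1(a,b)=\begin{cases}\dfrac18\,\dfrac{f^+(a,b)}{f^+(a,b)^2+f^-(a,b)^2} & \text{if } a\ne 1,\ \psi^+(a,b)<0,\ \psi^+(a,b)\neq -1,\\[2mm] 0 & \text{if } a\neq 1,\ \psi^+(a,b)=-1,\\ -\dfrac38 & \text{if } a=1, \text{ or if } a\neq 1,\ \psi^+(a,b)\ge 0 \text{ and } |a|\le 1,\\[1mm] \dfrac18 & \text{if } a\neq 1,\ \psi^+(a,b)\ge 0 \text{ and } |a|>1,\end{cases}$$ and $C_2(a,b)=C_1(b,a)$. *)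

(* Defs.v *)
From mathcomp Require Import all_boot all_order all_algebra.
From mathcomp Require Import reals.

Set Implicit Arguments.
Unset Strict Implicit.
Unset Printing Implicit Defensive.

Import Order.TTheory GRing.Theory Num.Theory.
Local Open Scope ring_scope.

(* Quantities living at the interface i + 1/2 are indexed by i : int, so that
   [dv v i] is the jump v_{i+1} - v_i across i + 1/2. *)
Definition dv (R : realType) (v : int -> R) (i : int) : R := v (i + 1) - v i.

(* Only meaningful for a != 1; every use below is guarded by that test. *)
Definition psi_plus (R : realType) (a b : R) : R := (1 - b) / (1 - a).

Definition f_plus (R : realType) (a b : R) : R :=
  if (a != 1) && (psi_plus a b != -1) then (1 + psi_plus a b)^-1 else 1.

Definition f_minus (R : realType) (a b : R) : R := f_plus b a.

Definition C1 (R : realType) (a b : R) : R :=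
  if a == 1 then - (3 / 8)
  else if psi_plus a b == -1 then 0
  else if psi_plus a b < 0 then
    1 / 8 * (f_plus a b / (f_plus a b ^+ 2 + f_minus a b ^+ 2))
  else if `|a| <= 1 then - (3 / 8)
  else 1 / 8.

Definition C2 (R : realType) (a b : R) : R := C1 b a.

(* [theta_plus v i] is theta^+_i, while [theta_minus v i] is theta^-_{i+1}:
   both are attached to the interface i + 1/2, and are used only when
   [dv v i != 0]. *)
Definition theta_plus (R : realType) (v : int -> R) (i : int) : R :=
  dv v (i - 1) / dv v i.

Definition theta_minus (R : realType) (v : int -> R) (i : int) : R :=
  dv v (i + 1) / dv v i.

Definition w0 (R : realType) (v : int -> R) (i : int) : R :=
  if dv v i == 0 then 1
  else 3 / 4 + 2 * C1 (theta_plus v i) (theta_minus v i).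

Definition w1 (R : realType) (v : int -> R) (i : int) : R :=
  if dv v i == 0 then 0
  else 1 / 4 - 2 * C1 (theta_plus v i) (theta_minus v i).

Definition wt0 (R : realType) (v : int -> R) (i : int) : R :=
  if dv v i == 0 then 0
  else 1 / 4 - 2 * C2 (theta_plus v i) (theta_minus v i).

Definition wt1 (R : realType) (v : int -> R) (i : int) : R :=
  if dv v i == 0 then 1
  else 3 / 4 + 2 * C2 (theta_plus v i) (theta_minus v i).

Definition v_minus (R : realType) (v : int -> R) (i : int) : R :=
  w0 v i * (v i / 2 + v (i + 1) / 2)
  + w1 v i * (- (v (i - 1) / 2) + 3 * v i / 2).

Definition v_plus (R : realType) (v : int -> R) (i : int) : R :=
  wt0 v i * (- (v (i + 2) / 2) + 3 * v (i + 1) / 2)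
  + wt1 v i * (v i / 2 + v (i + 1) / 2).

Definition rec_jump (R : realType) (v : int -> R) (i : int) : R :=
  v_plus v i - v_minus v i.

(* Main.v *)
Require Import Defs.
From mathcomp Require Import all_boot all_order all_algebra.
From mathcomp Require Import reals.
From mathcomp Require Import ring lra.

Import Order.TTheory GRing.Theory Num.Theory.
Local Open Scope ring_scope.

(** Writing [a], [b] for the two jump ratios, the reconstructed jump is
    [dv v i / 2] times [w1 * (1 - a) + wt0 * (1 - b)].  If [psi_plus a b < 0],
    the two terms cancel.  Otherwise [w1] is [1] when [|a| <= 1] and [0] when
    [|a| > 1], so that [|w1 * (1 - a)| <= 2]; likewise for the other term. *)

Lemma psi_plus_sym (R : realType) (a b : R) : psi_plus b a = (psi_plus a b)^-1.
Proof. by rewrite /psi_plus invf_div. Qed.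

Lemma weighted_term_le2 (R : realType) (a b : R) : 0 <= psi_plus a b ->
  `|(1 / 4 - 2 * C1 a b) * (1 - a)| <= 2.
Proof.
move=> psi_ge0; rewrite /C1.
(* Division by zero gives [psi_plus 1 b = 0], so the hypothesis admits a = 1; the factor 1 - a then
   vanishes. *)
have [->|_] := eqVneq a 1; first by rewrite subrr mulr0 normr0.
have -> : (psi_plus a b == -1) = false by apply/eqP; lra.
rewrite ltNge psi_ge0 /=.
have [/ler_normlP[? ?]|_] := boolP (`|a| <= 1); first by apply/ler_normlP; split; lra.
by apply/ler_normlP; split; lra.
Qed.

(** Put x = 1 - a and y = 1 - b. If x + y is nonzero, [C1 a b] is x (x + y) / (8 (x^2 + y^2)), so
    the first term is x y (y - x) / (4 (x^2 + y^2)), which is antisymmetric in x and y. *)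
Lemma weighted_terms_cancel (R : realType) (a b : R) : psi_plus a b < 0 ->
  (1 / 4 - 2 * C1 a b) * (1 - a) + (1 / 4 - 2 * C1 b a) * (1 - b) = 0.
Proof.
move=> psi_lt0.
have psi'_lt0 : psi_plus b a < 0 by rewrite psi_plus_sym invr_lt0.
have a1 : a != 1.
  by apply: contraTneq psi_lt0 => ->; rewrite /psi_plus subrr invr0 mulr0 ltxx.
have b1 : b != 1.
  by apply: contraTneq psi_lt0 => ->; rewrite /psi_plus subrr mul0r ltxx.
have a1' : 1 - a != 0 by rewrite subr_eq0 eq_sym.
have b1' : 1 - b != 0 by rewrite subr_eq0 eq_sym.
have psiN1 : (psi_plus b a == -1) = (psi_plus a b == -1).
  by rewrite psi_plus_sym -(inj_eq invr_inj) invrK invrN1.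
rewrite /C1 /f_minus /f_plus (negPf a1) (negPf b1) psi_lt0 psi'_lt0 psiN1 /=.
(* At ratio -1 both values of [C1] are 0, so the two weights equal 1/4 and the factors 1 - a, 1 - b
   are opposite. *)
have [psiE|psi_neq] := eqVneq (psi_plus a b) (-1).
  have : 1 - b = - (1 - a) by rewrite -[1 - b](divfK a1') -/(psi_plus a b) psiE mulN1r.
  lra.
have s0 : 1 - a + (1 - b) != 0.
  apply: contra_neq psi_neq => s0; rewrite /psi_plus.
  have -> : 1 - b = - (1 - a) by lra.
  by rewrite mulNr divff.
have sq0 : (1 - a) ^+ 2 + (1 - b) ^+ 2 != 0.
  by rewrite paddr_eq0 ?sqr_ge0// !sqrf_eq0 (negPf a1').
have inv1D (x y : R) : x != 0 -> x + y != 0 -> (1 + y / x)^-1 = x / (x + y).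
  by move=> x0 xy0; rewrite -[X in X + _](divff x0) -mulrDl invf_div.
have s0' : 1 - b + (1 - a) != 0 by rewrite addrC.
rewrite /= /psi_plus !inv1D //.
field.
(* The remaining denominator factors as [(1 - a) ^+ 2 + (1 - b) ^+ 2] times the square of
   [1 - a + (1 - b)]. *)
rewrite s0 [1 - b + _]addrC !exprMn -mulrDl [X in X * _]addrC.
by rewrite mulf_neq0 ?expf_neq0.
Qed.

(** On each side the weights sum to 1, so the central average drops out of the jump. The left
    extrapolation is that average minus [dv v i / 2 * (1 - a)], the right one the average plus
    [dv v i / 2 * (1 - b)]. *)
Lemma rec_jumpE (R : realType) (v : int -> R) (i : int) : dv v i != 0 ->
  let a := theta_plus v i in let b := theta_minus v i in
  rec_jump v i = dv v i / 2 *
    ((1 / 4 - 2 * C1 a b) * (1 - a) + (1 / 4 - 2 * C1 b a) * (1 - b)).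
Proof.
move=> dv0 a b.
have aE : v i - v (i - 1) = a * dv v i.
  by rewrite /a /theta_plus divfK // /dv subrK.
have bE : v (i + 2) - v (i + 1) = b * dv v i.
  by rewrite /b /theta_minus divfK // /dv -addrA.
have dE : v (i + 1) - v i = dv v i by [].
rewrite /rec_jump /v_plus /v_minus /w0 /w1 /wt0 /wt1 /C2 (negPf dv0) -/a -/b.
have -> : v (i + 2) = v i + dv v i + b * dv v i by lra.
have -> : v (i - 1) = v i - a * dv v i by lra.
have -> : v (i + 1) = v i + dv v i by lra.
by field.
Qed.

Theorem lemma3 (R : realType) (v : int -> R) :
  forall i : int, `|rec_jump v i| <= 2 * `|dv v i|.
Proof.
move=> i; have [dv0|dv0] := eqVneq (dv v i) 0.
  have vE : v (i + 1) = v i by apply/eqP; rewrite -subr_eq0; apply/eqP.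
  rewrite /rec_jump /v_plus /v_minus /w0 /w1 /wt0 /wt1 dv0 eqxx vE.
  by rewrite !mul0r !mul1r add0r addr0 subrr normr0 mulr0.
rewrite rec_jumpE //=; set a := theta_plus v i; set b := theta_minus v i.
(* The bound 4 allows 2 for each term; the prefactor 1/2 brings it down to 2. *)
suff le4 : `|(1 / 4 - 2 * C1 a b) * (1 - a) + (1 / 4 - 2 * C1 b a) * (1 - b)| <= 4.
  rewrite !normrM (@gtr0_norm _ 2^-1) ?invr_gt0 ?ltr0n //.
  by have := ler_wpM2l (normr_ge0 (dv v i)) le4; lra.
have [psi_ge0|psi_lt0] := leP 0 (psi_plus a b); last first.
  by rewrite weighted_terms_cancel // normr0.
(* This includes [psi_plus a b = 0], since the inverse of 0 is 0. *)
have psi'_ge0 : 0 <= psi_plus b a by rewrite psi_plus_sym invr_ge0.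
apply: le_trans (ler_normD _ _) _.
by have := weighted_term_le2 _ _ _ psi_ge0; have := weighted_term_le2 _ _ _ psi'_ge0; lra.
Qed.
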